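(* Let $M$ be a $\mathbb{Z}^n$-graded submodule of a finitely generated $\mathbb{Z}^n$-graded free $S$-module $F_0$, and let $$\cdots\to F_p\to F_{p-1}\to\cdots\to F_1\to M\to 0$$ be a $\mathbb{Z}^n$-graded (not necessarily minimal) free resolution of $M$ with all $F_i$ finitely generated. Let $0\le p\le n$ be an integer, let $Z_p\subseteq F_p$ be the $p$-th syzygy module, and let $\mathcal F=e_1,\dots,e_m$ be a lex-refined basis of $F_p$. Then $\operatorname{in}_{\mathcal F}(Z_p)=\bigoplus_{j=1}^m I_je_j$, where the $I_j\subseteq S$ are monomial ideals and the minimal set of monomial generators of each $I_j$ belongs to $K[x_{p+1},\dots,x_n]$.
   Context: $K$ is a field and $S=K[x_1,\dots,x_n]$ with its standard $\mathbb{Z}^n$-grading. Syzygy modules: composing $F_1\to M$ with the inclusion $M\subseteq F_0$ gives maps $F_p\to F_{p-1}$ for all $p\ge 1$; set $Z_0=M\subseteq F_0$ and $Z_p=\ker(F_p\to F_{p-1})\subseteq F_p$ for $p\ge1$. Initial modules: let $F$ be a finitely generated $\mathbb{Z}^n$-graded free $S$-module with ordered multihomogeneous basis $\mathcal F=e_1,\dots,e_m$. Fix any monomial order $<$ on $S$ and order the monomials of $F$ by $ue_i>ve_j$ if $i<j$, or $i=j$ and $u>v$ ($u,v$ monomials of $S$). For a $\mathbb{Z}^n$-graded submodule $N\subseteq F$, $\operatorname{in}_{\mathcal F}(N)$ is the submodule of $F$ generated by all initial monomials of elements of $N$; it depends only on $\mathcal F$, not on $<$, and has the form $\bigoplus_j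 I_je_j$ with monomial ideals $I_j$. The basis $\mathcal F$ is lex-refined if $\deg(e_1)\ge\deg(e_2)\ge\cdots\ge\deg(e_m)$ in the lexicographical order on $\mathbb{Z}^n$ (compare first coordinates first). *)

(* Defs.v *)
From mathcomp Require Import all_boot all_order all_algebra.
From mathcomp Require Import mpoly.

Set Implicit Arguments.
Unset Strict Implicit.
Unset Printing Implicit Defensive.

Import Order.TTheory GRing.Theory.
Local Open Scope ring_scope.

Definition mdegZ (n : nat) (u : 'X_{1..n}) : 'rV[int]_n := \row_i (u i)%:Z.

Definition std_grading (K : fieldType) (n : nat) (a : 'rV[int]_n)
  (f : {mpoly K[n]}) : Prop := forall u, u \in msupp f -> mdegZ u = a.

(* Coordinates are compared from the first one on. *)
Definition lexle (n : nat) (a b : 'rV[int]_n) : bool :=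
  (([tuple a ord0 i | i < n] : n.-tuplelexi int)
     <= ([tuple b ord0 i | i < n] : n.-tuplelexi int))%O.

Record monomial_order (n : nat) (le : rel 'X_{1..n}) : Prop := MonomialOrder {
  mo_refl : reflexive le;
  mo_anti : antisymmetric le;
  mo_trans : transitive le;
  mo_total : total le;
  mo_one : forall u, le 0%MM u;
  mo_mul : forall u v w, le u v -> le (u + w)%MM (v + w)%MM }.

Section Modules.
Variables (K : fieldType) (n : nat).
Local Notation S := {mpoly K[n]}.

Record submodule (V : lmodType S) (N : V -> Prop) : Prop := Submodule {
  subm0 : N 0;
  submD : forall x y, N x -> N y -> N (x + y);
  submZ : forall (f : S) x, N x -> N (f *: x) }.

Definition generated (V : lmodType S) (X : V -> Prop) (v : V) : Prop :=
  forall N : V -> Prop, submodule N -> (forall x, X x -> N x) -> N v.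

(* [gr a] is the homogeneous component of multidegree [a]; the module is the
   internal direct sum of these components. *)
Record multigrading (V : lmodType S) (gr : 'rV[int]_n -> V -> Prop) : Prop :=
  Multigrading {
  mg0 : forall a, gr a 0;
  mgD : forall a x y, gr a x -> gr a y -> gr a (x + y);
  mgZ : forall a b f x, std_grading a f -> gr b x -> gr (a + b) (f *: x);
  mg_sum : forall v, exists k (a : 'I_k -> 'rV[int]_n) (x : 'I_k -> V),
    (forall i, gr (a i) (x i)) /\ v = \sum_i x i;
  mg_direct : forall k (a : 'I_k -> 'rV[int]_n) (x : 'I_k -> V),
    injective a -> (forall i, gr (a i) (x i)) -> \sum_i x i = 0 ->
    forall i, x i = 0 }.

Definition graded_submodule (V : lmodType S) (gr : 'rV[int]_n -> V -> Prop)
    (N : V -> Prop) : Prop :=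
  submodule N /\
  forall v, N v -> exists k (a : 'I_k -> 'rV[int]_n) (x : 'I_k -> V),
    (forall i, gr (a i) (x i) /\ N (x i)) /\ v = \sum_i x i.

Definition is_basis (V : lmodType S) (m : nat) (e : 'I_m -> V) : Prop :=
  forall v, exists! c : {ffun 'I_m -> S}, v = \sum_j c j *: e j.

Definition fg_graded_free (V : lmodType S) (gr : 'rV[int]_n -> V -> Prop) :
    Prop :=
  multigrading gr /\
  exists m (e : 'I_m -> V) (d : 'I_m -> 'rV[int]_n),
    is_basis e /\ forall j, gr (d j) (e j).

Definition lex_refined_basis (V : lmodType S) (gr : 'rV[int]_n -> V -> Prop)
    (m : nat) (e : 'I_m -> V) : Prop :=
  is_basis e /\
  exists d : 'I_m -> 'rV[int]_n,
    (forall j, gr (d j) (e j)) /\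
    (forall j k : 'I_m, (j <= k)%N -> lexle (d k) (d j)).

(* [F 0] is only the ambient module of [M]: the module resolved by
   [F 1, F 2, ...] is [M], and [phi 0 : F 1 -> F 0] is the composite
   of [F 1 -> M] with the inclusion of [M]. *)
Record graded_free_resolution (F : nat -> lmodType S)
    (gr : forall i, 'rV[int]_n -> F i -> Prop) (M : F 0%N -> Prop)
    (phi : forall i, {linear F i.+1 -> F i}) : Prop := GradedFreeResolution {
  gfr_free : forall i, fg_graded_free (gr i.+1);
  gfr_homog : forall i a x, gr i.+1 a x -> gr i a (phi i x);
  gfr_onto : forall y, M y <-> exists x, phi 0%N x = y;
  gfr_exact : forall i y, phi i y = 0 <-> exists x, phi i.+1 x = y }.

Definition syzygy (F : nat -> lmodType S) (M : F 0%N -> Prop)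
    (phi : forall i, {linear F i.+1 -> F i}) (p : nat) : F p -> Prop :=
  match p return F p -> Prop with
  | 0%N => M
  | q.+1 => fun v => phi q v = 0
  end.

(* The pair (u, j) stands for the monomial u e_j. *)
Definition monF_gt (le : rel 'X_{1..n}) (m : nat) (w w' : 'X_{1..n} * 'I_m) :
    Prop :=
  (w.2 < w'.2)%N \/ [/\ w.2 = w'.2, w.1 != w'.1 & le w'.1 w.1].

Definition is_initial (le : rel 'X_{1..n}) (V : lmodType S) (m : nat)
    (e : 'I_m -> V) (v : V) (w : 'X_{1..n} * 'I_m) : Prop :=
  exists c : {ffun 'I_m -> S},
    [/\ v = \sum_j c j *: e j,
        w.1 \in msupp (c w.2)
      & forall w' : 'X_{1..n} * 'I_m,
          w'.1 \in msupp (c w'.2) -> w' != w -> monF_gt le w w'].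

Definition initial_module (le : rel 'X_{1..n}) (V : lmodType S) (m : nat)
    (e : 'I_m -> V) (N : V -> Prop) : V -> Prop :=
  generated (fun x => exists v w,
    [/\ N v, is_initial le e v w & x = 'X_[w.1] *: e w.2]).

(* Ideals of S are the submodules of the regular module S^o. *)
Definition ideal_of_monomials (G : 'X_{1..n} -> Prop) : S^o -> Prop :=
  generated (V := S^o) (fun f => exists2 u, G u & f = 'X_[u]).

Definition generates (G : 'X_{1..n} -> Prop) (I : S^o -> Prop) : Prop :=
  forall f, I f <-> ideal_of_monomials G f.

Definition monomial_ideal (I : S^o -> Prop) : Prop := exists G, generates G I.

Definition min_monomial_gens (I : S^o -> Prop) (G : 'X_{1..n} -> Prop) : Prop :=
  generates G I /\
  forall G' : 'X_{1..n} -> Prop,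
    (forall u, G' u -> G u) -> generates G' I -> forall u, G u -> G' u.

Definition sum_of_ideals (V : lmodType S) (m : nat) (e : 'I_m -> V)
    (I : 'I_m -> S^o -> Prop) (v : V) : Prop :=
  exists c : 'I_m -> S, (forall j, I j (c j)) /\ v = \sum_j c j *: e j.

(* Indices start at 0, so x_{p+1}, ..., x_n are the 'X_i with p <= i < n. *)
Definition in_last_vars (p : nat) (f : S) : Prop :=
  forall u, u \in msupp f -> forall i : 'I_n, (i < p)%N -> u i = 0%N.

End Modules.

(* Main.v *)
Require Import Defs.
From mathcomp Require Import all_boot all_order all_algebra.
From mathcomp Require Import mpoly.
From Stdlib Require Import Classical.
Import Order.TTheory GRing.Theory Num.Theory.
Local Open Scope ring_scope.

Set Implicit Arguments.
Unset Strict Implicit.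
Unset Printing Implicit Defensive.

(** Let [A j] be the set of monomials [u] such that [u e_j] is the initial
    monomial of an element of [Z_p].  The initial module is the direct sum of
    the ideals [I_j] generated by the [A j] ([initial_moduleE]), and the minimal
    generators of [I_j] are the elements of [A j] that are minimal for
    divisibility ([minimal_monomials_gens], [min_monomial_gens_sub]).  So it is
    enough to show that a monomial [u] of [A j] that involves one of
    [x_1, ..., x_p] is not minimal: if [x_i] is the first variable dividing [u],
    and [i <= p], then [u / x_i] is in [A j] too ([initial_div_var]).

    Let [z] be a syzygy with initial monomial [u e_j]; as [Z_p] is graded
    ([kernel_mhcomp]), [z] may be taken multihomogeneous.  Every monomial
    [u' e_k] of [z] has [k >= j], hence [deg e_k <= deg e_j] lexicographically.
    If [u'] involves none of [x_1, ..., x_(i-1)], then [e_k] and [e_j] agree in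
    the first [i-1] degrees, because [u] does not involve these variables either;
    so the [i]-th degree of [e_k] is at most that of [e_j], and [x_i] divides
    [u'].  Thus [z] lies in [(x_1, ..., x_i) F_p].

    The variables form a regular sequence on each [F_q], so the complex remains
    exact at [F_p] modulo [x_1, ..., x_(i-1)] when [i <= p]
    ([exact_mod_vars]).  Writing [z = x_i g + h] with [h] in
    [(x_1, ..., x_(i-1)) F_p], the class of [g] is a cycle, hence lifts to a
    syzygy [z'] with [z - x_i z'] in [(x_1, ..., x_(i-1)) F_p]
    ([kernel_div_var]).  A last comparison of degrees shows that the component
    of [z'] of degree [deg z - deg x_i] has no coordinate before [e_j] and has a
    nonzero multiple of [u / x_i] as its coordinate at [e_j].

    In the lemmas below the variables are numbered from [0]. *)

(** * Submodules *)

Lemma submN (K : fieldType) (n : nat) (V : lmodType {mpoly K[n]})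
    (N : V -> Prop) :
  submodule N -> forall x, N x -> N (- x).
Proof. by move=> [_ _ NZ] x Nx; rewrite -scaleN1r; apply: NZ. Qed.

Lemma subm_sum (K : fieldType) (n : nat) (V : lmodType {mpoly K[n]})
    (N : V -> Prop) (I : eqType) (s : seq I) (x : I -> V) :
  submodule N -> (forall i, i \in s -> N (x i)) -> N (\sum_(i <- s) x i).
Proof.
move=> sN; elim: s => [_|i s IHs Nx].
  by rewrite big_nil; apply: (Defs.subm0 sN).
rewrite big_cons; apply: (submD sN); first by apply: Nx; rewrite mem_head.
by apply: IHs => j js; apply: Nx; rewrite inE js orbT.
Qed.

Lemma generated_submodule (K : fieldType) (n : nat) (V : lmodType {mpoly K[n]})
    (X : V -> Prop) :
  submodule (generated X).
Proof.
split=> [N sN _ | x y gx gy N sN XN | f x gx N sN XN].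
- exact: (Defs.subm0 sN).
- by apply: (submD sN); [apply: gx | apply: gy].
- by apply: (submZ sN); apply: gx.
Qed.

(** * Multiples of the first variables *)

(** No variable of index less than [r] divides the monomial [u]. *)
Definition vanish_below (n r : nat) (u : 'X_{1..n}) : Prop :=
  forall l : 'I_n, (l < r)%N -> u l = 0%N.

(** Membership in [(x_l : l < r) V].  The definition needs no basis of [V], so
    that linear maps visibly respect it. *)
Definition var_multiples (K : fieldType) (n r : nat)
    (V : lmodType {mpoly K[n]}) (v : V) : Prop :=
  exists w : 'I_n -> V, v = \sum_(l < n | (l < r)%N) ('X_l : {mpoly K[n]}) *: w l.

Lemma var_multiples_submodule (K : fieldType) (n r : nat)
    (V : lmodType {mpoly K[n]}) :
  submodule (var_multiples r (V := V)).
Proof.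
split.
- by exists (fun=> 0); rewrite big1 // => l _; rewrite scaler0.
- move=> _ _ [w ->] [w' ->]; exists (fun l => w l + w' l).
  by rewrite -big_split; apply: eq_bigr => l _; rewrite scalerDr.
- move=> f _ [w ->]; exists (fun l => f *: w l).
  by rewrite scaler_sumr; apply: eq_bigr => l _; rewrite !scalerA mulrC.
Qed.

Lemma var_multiplesX (K : fieldType) (n r : nat) (V : lmodType {mpoly K[n]})
    (l : 'I_n) (v : V) :
  (l < r)%N -> var_multiples r (('X_l : {mpoly K[n]}) *: v).
Proof.
move=> lr; exists (fun k => if k == l then v else 0).
rewrite (bigD1 l) //= eqxx big1 ?addr0 // => k /andP[_ /negPf ->].
by rewrite scaler0.
Qed.

Lemma var_multiplesW (K : fieldType) (n r s : nat) (V : lmodType {mpoly K[n]})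
    (v : V) :
  (r <= s)%N -> var_multiples r v -> var_multiples s v.
Proof.
move=> rs [w ->]; exists (fun l : 'I_n => if (l < r)%N then w l else 0).
rewrite [LHS]big_mkcond [RHS]big_mkcond /=.
apply: eq_bigr => l _; case: ifP => [lr|_]; last by rewrite scaler0 if_same.
by rewrite (leq_trans lr rs).
Qed.

Lemma var_multiplesS (K : fieldType) (n : nat) (V : lmodType {mpoly K[n]})
    (i : 'I_n) (v : V) :
  var_multiples i.+1 v ->
  exists g h, var_multiples i h /\ v = ('X_i : {mpoly K[n]}) *: g + h.
Proof.
move=> [w ->]; exists (w i).
exists (\sum_(l < n | (l < i)%N) ('X_l : {mpoly K[n]}) *: w l).
split; first by exists w.
rewrite (bigD1 i) //=; congr (_ + _); apply: eq_bigl => l.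
by rewrite ltnS andbC ltn_neqAle.
Qed.

Lemma var_multiples_linear (K : fieldType) (n r : nat)
    (V W : lmodType {mpoly K[n]}) (f : {linear V -> W}) (v : V) :
  var_multiples r v -> var_multiples r (f v).
Proof.
move=> [w ->]; exists (fun l => f (w l)).
by rewrite linear_sum; apply: eq_bigr => l _; rewrite linearZ.
Qed.

Lemma mcoeff_XM (K : fieldType) (n : nat) (i : 'I_n) (f : {mpoly K[n]})
    (u : 'X_{1..n}) :
  ('X_i * f)@_(u + U_(i))%MM = f@_u.
Proof. by rewrite mulrC addmC mcoeffMX. Qed.

Lemma mcoeff_XM0 (K : fieldType) (n : nat) (i : 'I_n) (f : {mpoly K[n]})
    (u : 'X_{1..n}) :
  u i = 0%N -> ('X_i * f)@_u = 0.
Proof.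
move=> ui; apply/eqP; rewrite mcoeff_eq0; apply/negP => /msuppM_le.
case/allpairsP=> [[a b]] /= []; rewrite msuppX inE => /eqP -> _ def_u.
by move: ui; rewrite def_u mnmDE mnm1E eqxx.
Qed.

Lemma basis_coord_inj (K : fieldType) (n m : nat) (V : lmodType {mpoly K[n]})
    (e : 'I_m -> V) (c c' : {ffun 'I_m -> {mpoly K[n]}}) :
  is_basis e -> \sum_j c j *: e j = \sum_j c' j *: e j -> c = c'.
Proof.
move=> he eq_cc'; have [c0 [_ c0_uniq]] := he (\sum_j c j *: e j).
by rewrite -(c0_uniq c) // -(c0_uniq c').
Qed.

(** On a free module, [(x_l : l < r) V] is described by the coordinates: all
    their monomials are divisible by some [x_l] with [l < r]. *)
Lemma var_multiples_coordP (K : fieldType) (n m r : nat)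
    (V : lmodType {mpoly K[n]}) (e : 'I_m -> V)
    (c : {ffun 'I_m -> {mpoly K[n]}}) :
  is_basis e ->
  var_multiples r (\sum_j c j *: e j) <->
  forall j u, vanish_below r u -> (c j)@_u = 0.
Proof.
move=> he; split=> [[w def_c] j u u0 | c0].
  have ex_d l : exists d : {ffun 'I_m -> {mpoly K[n]}}, w l = \sum_j d j *: e j.
    by have [d [? _]] := he (w l); exists d.
  have [d def_w] := fin_all_exists ex_d.
  pose c' := [ffun k => \sum_(l < n | (l < r)%N) 'X_l * d l k]
    : {ffun 'I_m -> {mpoly K[n]}}.
  have -> : c = c'.
    apply: (basis_coord_inj he); rewrite def_c.
    transitivity (\sum_(l < n | (l < r)%N) \sum_k ('X_l * d l k) *: e k).
      apply: eq_bigr => l _; rewrite def_w scaler_sumr.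
      by apply: eq_bigr => k _; rewrite scalerA.
    by rewrite exchange_big; apply: eq_bigr => k _; rewrite ffunE scaler_suml.
  rewrite ffunE raddf_sum big1 // => l lr; apply: mcoeff_XM0; exact: u0.
have sM := var_multiples_submodule r V.
apply: (subm_sum sM) => j _.
rewrite [c j]mpolyE scaler_suml; apply: (subm_sum sM) => u.
rewrite mcoeff_msupp => cu.
have [l /andP[lr ul]] : exists l : 'I_n, (l < r)%N && (u l != 0%N).
  apply/existsP; apply: contraR cu => /existsPn no_l; apply/eqP/c0 => l lr.
  by apply/eqP; move: (no_l l); rewrite lr negbK.
rewrite -mul_mpolyC -scalerA; apply: (submZ sM).
have def_u : (U_(l) + (u - U_(l)) = u)%MM by rewrite addmC submK // lep1mP.
by rewrite -def_u mpolyXD -scalerA; apply: var_multiplesX.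
Qed.

(** A variable of index at least [r] is a nonzerodivisor on
    [V / (x_l : l < r) V] when [V] is free. *)
Lemma var_multiples_regular (K : fieldType) (n m r : nat)
    (V : lmodType {mpoly K[n]}) (e : 'I_m -> V) (i : 'I_n) (v : V) :
  is_basis e -> (r <= i)%N ->
  var_multiples r (('X_i : {mpoly K[n]}) *: v) -> var_multiples r v.
Proof.
move=> he ri; have [c [-> _]] := he v.
pose c' := [ffun k => 'X_i * c k] : {ffun 'I_m -> {mpoly K[n]}}.
have -> : 'X_i *: (\sum_j c j *: e j) = \sum_j c' j *: e j.
  by rewrite scaler_sumr; apply: eq_bigr => j _; rewrite ffunE scalerA.
rewrite !var_multiples_coordP // => c'0 j u u0.
rewrite -(mcoeff_XM i); have := c'0 j (u + U_(i))%MM; rewrite ffunE; apply.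
move=> l lr; rewrite mnmDE u0 // mnm1E.
by case: eqP => // il; move: lr; rewrite -il ltnNge ri.
Qed.

(** If [x_i g + h], with [h] in [(x_l : l < r) V], becomes [0] modulo
    [(x_l : l < r)] under a linear map into a free module, then so does [g]. *)
Lemma var_multiples_cycle (K : fieldType) (n m r : nat)
    (V W : lmodType {mpoly K[n]}) (f : {linear V -> W}) (e : 'I_m -> W)
    (i : 'I_n) (g h : V) :
  is_basis e -> (r <= i)%N -> var_multiples r h ->
  f (('X_i : {mpoly K[n]}) *: g + h) = 0 -> var_multiples r (f g).
Proof.
move=> he ri Mh fgh0; apply: (var_multiples_regular he ri).
have -> : 'X_i *: f g = - f h.
  by apply/eqP; rewrite -addr_eq0 -linearZ -linearD fgh0.
by apply: (submN (var_multiples_submodule r W)); apply: var_multiples_linear.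
Qed.

Lemma fg_graded_free_basis (K : fieldType) (n : nat) (V : lmodType {mpoly K[n]})
    (gr : 'rV[int]_n -> V -> Prop) :
  fg_graded_free gr -> exists m (e : 'I_m -> V), is_basis e.
Proof. by move=> [_ [m [e [d [he _]]]]]; exists m, e. Qed.

(** * Exactness modulo the first variables *)

(** An exact complex of free modules stays exact modulo the first [r] variables
    at the places with at least [r + 1] maps to their right (here [F q.+1] with
    [r <= q]); this is the vanishing of Tor against [S / (x_1, ..., x_r)] in
    degrees above [r]. *)
Lemma exact_mod_vars (K : fieldType) (n : nat) (F : nat -> lmodType {mpoly K[n]})
    (phi : forall i, {linear F i.+1 -> F i}) :
  (forall i, exists m (e : 'I_m -> F i), is_basis e) ->
  (forall i y, phi i y = 0 <-> exists x, phi i.+1 x = y) ->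
  forall r q, (r <= n)%N -> (r <= q)%N ->
  forall y, var_multiples r (phi q y) ->
  exists w, var_multiples r (y - phi q.+1 w).
Proof.
move=> freeF exF; elim=> [|r IHr] q rn rq y.
  case=> w; rewrite big_pred0 // => /exF[x <-]; exists x.
  by rewrite subrr; apply: (Defs.subm0 (var_multiples_submodule 0 _)).
case: q rq y => // q rq y.
have sM i := var_multiples_submodule r (F i).
(* [phi q.+1 y = x g + h] with [h] a multiple of the previous variables; lifting
   [g] to [w] modulo these variables, the induction applies to [y - x w]. *)
move=> /(var_multiplesS (i := Ordinal rn)) /= [g [h [Mh def_y]]].
set x := 'X_(_) in def_y.
have phi2 : phi q (phi q.+1 y) = 0 by apply/exF; exists y.
have Mg : var_multiples r (phi q g).
  have [m [e he]] := freeF q.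
  by apply: (var_multiples_cycle (i := Ordinal rn) (h := h) he); rewrite // -def_y.
have [w Mw] := IHr q (ltnW rn) rq g Mg.
have My : var_multiples r (phi q.+1 (y - x *: w)).
  rewrite linearB linearZ /= def_y addrAC -scalerBr.
  by apply: (submD (sM _)) => //; apply: (submZ (sM _)).
have [w' Mw'] := IHr q.+1 (ltnW rn) (ltnW rq) _ My.
exists w'; rewrite -(subrK (x *: w) y) addrAC.
apply: (submD (var_multiples_submodule r.+1 _)) => //.
  exact: (var_multiplesW (leqnSn r)).
exact: var_multiplesX.
Qed.

(** For [i <= q], a cycle in [(x_l : l <= i) F_(q+1)] is, modulo
    [(x_l : l < i) F_(q+1)], the product of [x_i] and a cycle. *)
Lemma kernel_div_var (K : fieldType) (n : nat) (F : nat -> lmodType {mpoly K[n]})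
    (phi : forall i, {linear F i.+1 -> F i}) (i : 'I_n) (q : nat)
    (z : F q.+1) :
  (forall i, exists m (e : 'I_m -> F i), is_basis e) ->
  (forall i y, phi i y = 0 <-> exists x, phi i.+1 x = y) ->
  (i <= q)%N -> phi q z = 0 -> var_multiples i.+1 z ->
  exists z', phi q z' = 0 /\ var_multiples i (z - ('X_i : {mpoly K[n]}) *: z').
Proof.
move=> freeF exF iq phi_z /var_multiplesS[g [h [Mh def_z]]].
have sM k := var_multiples_submodule i (F k).
have Mg : var_multiples i (phi q g).
  have [m [e he]] := freeF q.
  by apply: (var_multiples_cycle (i := i) (h := h) he); rewrite // -def_z.
have [w Mw] := exact_mod_vars freeF exF (ltnW (ltn_ord i)) iq Mg.
exists (phi q.+1 w); split; first by apply/exF; exists w.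
rewrite def_z addrAC -scalerBr.
by apply: (submD (sM _)) => //; apply: (submZ (sM _)).
Qed.

(** * Multihomogeneous components *)

Lemma mdegZ_inj (n : nat) : injective (@mdegZ n).
Proof.
move=> u v /rowP eq_uv; apply/mnmP => i.
by have := eq_uv i; rewrite !mxE => -[].
Qed.

(** The component of multidegree [b] of the polynomial [f]; it has at most one
    term. *)
Definition mhcomp (K : fieldType) (n : nat) (b : 'rV[int]_n)
    (f : {mpoly K[n]}) : {mpoly K[n]} :=
  \sum_(u <- msupp f | mdegZ u == b) f@_u *: 'X_[u].

Lemma mcoeff_mhcomp (K : fieldType) (n : nat) (b : 'rV[int]_n)
    (f : {mpoly K[n]}) (u : 'X_{1..n}) :
  (mhcomp b f)@_u = if mdegZ u == b then f@_u else 0.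
Proof.
rewrite raddf_sum /=.
under eq_bigr => v _ do rewrite mcoeffZ mcoeffX.
case: ifP => [ub | /negP ub]; last first.
  rewrite big1 // => v /eqP vb; case: eqP => [vu|]; last by rewrite mulr0.
  by case: ub; rewrite -vu vb.
rewrite [f in RHS]mpolyE raddf_sum /= big_mkcond.
apply: eq_bigr => v _; rewrite mcoeffZ mcoeffX.
case: ifP => // /negP vb; case: eqP => [vu|]; last by rewrite mulr0.
by case: vb; rewrite vu.
Qed.

Lemma std_grading_mhcomp (K : fieldType) (n : nat) (b : 'rV[int]_n)
    (f : {mpoly K[n]}) :
  std_grading b (mhcomp b f).
Proof.
move=> u; rewrite mcoeff_msupp mcoeff_mhcomp.
by case: (mdegZ u =P b) => //; rewrite eqxx.
Qed.

Lemma sum_mhcomp (K : fieldType) (n : nat) (s : seq 'rV[int]_n)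
    (f : {mpoly K[n]}) :
  uniq s -> (forall u, u \in msupp f -> mdegZ u \in s) ->
  \sum_(b <- s) mhcomp b f = f.
Proof.
move=> s_uniq s_f; apply/mpolyP => u; rewrite raddf_sum /=.
under eq_bigr => b _ do rewrite mcoeff_mhcomp.
have [us|us] := boolP (mdegZ u \in s).
  rewrite (bigD1_seq (mdegZ u)) //= eqxx big1 ?addr0 // => b.
  by rewrite eq_sym => /negPf ->.
rewrite big1_seq => [|b /= bs].
  by apply/esym/eqP; rewrite mcoeff_eq0; apply: contra us => /s_f.
by case: eqP => // def_b; case/negP: us; rewrite def_b.
Qed.

(** The kernel of a homogeneous map is graded, in terms of coefficients on
    homogeneous elements [e j]: the sum whose kernel membership is asserted is the
    component of multidegree [a] of [\sum_j c j *: e j]. *)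
Lemma kernel_mhcomp (K : fieldType) (n m : nat) (V W : lmodType {mpoly K[n]})
    (grV : 'rV[int]_n -> V -> Prop) (grW : 'rV[int]_n -> W -> Prop)
    (f : {linear V -> W}) (e : 'I_m -> V) (d : 'I_m -> 'rV[int]_n)
    (c : {ffun 'I_m -> {mpoly K[n]}}) (a : 'rV[int]_n) :
  multigrading grV -> multigrading grW ->
  (forall b x, grV b x -> grW b (f x)) -> (forall j, grV (d j) (e j)) ->
  f (\sum_j c j *: e j) = 0 ->
  f (\sum_j mhcomp (a - d j) (c j) *: e j) = 0.
Proof.
move=> mgV mgW f_gr gr_e fc0.
pose comp b := \sum_j mhcomp (b - d j) (c j) *: e j.
(* A duplicate-free list of the multidegrees that occur, together with [a]. *)
pose s := undup (a :: flatten [seq [seq mdegZ u + d j | u <- msupp (c j)]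
                              | j <- enum 'I_m]).
have gr_comp b : grV b (comp b).
  elim/big_rec: (comp b) => [|j x _ gr_x]; first exact: (mg0 mgV).
  apply: (mgD mgV) => //; rewrite -[b](subrK (d j)) addrK.
  by apply: (mgZ mgV) => //; apply: std_grading_mhcomp.
have sum_comp : \sum_(b <- s) comp b = \sum_j c j *: e j.
  rewrite exchange_big; apply: eq_bigr => j _; rewrite -scaler_suml.
  congr (_ *: _).
  rewrite -(big_map (fun b => b - d j) predT (fun b => mhcomp b (c j))).
  apply: sum_mhcomp => [|u cu].
    by rewrite map_inj_uniq ?undup_uniq //; apply: addIr.
  apply/mapP; exists (mdegZ u + d j); last by rewrite addrK.
  rewrite mem_undup inE; apply/orP; right; apply/flattenP.
  exists [seq mdegZ u + d j | u <- msupp (c j)]; last exact: map_f.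
  by apply: map_f; rewrite mem_enum.
have tn_inj : injective (tnth (in_tuple s)).
  by apply/tuple_uniqP; apply: undup_uniq.
have sum0 : \sum_i f (comp (tnth (in_tuple s) i)) = 0.
  by rewrite -linear_sum -(big_tnth _ _ _ predT comp) sum_comp.
have /tnthP[i def_a] : a \in in_tuple s by rewrite mem_undup mem_head.
rewrite -/(comp a) def_a.
have := mg_direct mgW tn_inj _ sum0 i; apply => j.
by apply: f_gr; apply: gr_comp.
Qed.

(** * Lexicographic comparison *)

(** If [a <= b] lexicographically while [b l <= a l] for every [l < i], then
    [a] and [b] agree before [i], so the comparison passes to coordinate [i]. *)
Lemma lexle_first (n : nat) (a b : 'rV[int]_n) (i : 'I_n) :
  lexle a b ->
  (forall l : 'I_n, (l < i)%N -> b ord0 l <= a ord0 l) ->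
  a ord0 i <= b ord0 i.
Proof.
case/Order.TupleLexiOrder.lexi_tupleP => k le_ab le_ba.
have [ik|ki] := leqP i k.
  by have [] := le_ab i ik; rewrite !tnth_mktuple.
pose l : 'I_n := Ordinal (ltn_trans ki (ltn_ord i)).
have [le_l eq_l] := le_ab l (leqnn k).
rewrite !tnth_mktuple in le_l eq_l.
by move: eq_l; rewrite /= eqxx eq_le le_l le_ba.
Qed.

Lemma lexle_first_eq (n : nat) (a b : 'rV[int]_n) (i : 'I_n) :
  lexle a b ->
  (forall l : 'I_n, (l < i)%N -> b ord0 l <= a ord0 l) ->
  forall l : 'I_n, (l < i)%N -> a ord0 l = b ord0 l.
Proof.
move=> le_ab le_ba l li; apply/eqP; rewrite eq_le le_ba // andbT.
by apply: lexle_first => // l' l'l; apply/le_ba/(ltn_trans l'l).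
Qed.

(** * Initial monomials of syzygies *)

(** Basis elements with a smaller index are larger, so a vector with initial
    monomial [u e_j] has zero coordinates before [j]. *)
Lemma is_initial_coord0 (K : fieldType) (n m : nat) (le : rel 'X_{1..n})
    (j : 'I_m) (u : 'X_{1..n}) (c : {ffun 'I_m -> {mpoly K[n]}}) :
  (forall w' : 'X_{1..n} * 'I_m,
      w'.1 \in msupp (c w'.2) -> w' != (u, j) -> monF_gt le (u, j) w') ->
  forall k : 'I_m, (k < j)%N -> c k = 0.
Proof.
move=> c_gt k kj; apply/mpolyP => u'; rewrite mcoeff0; apply/eqP.
rewrite mcoeff_eq0; apply/negP => cu'.
have neq_w : (u', k) != (u, j).
  by apply/eqP => -[_ eq_kj]; move: kj; rewrite eq_kj ltnn.
case: (c_gt (u', k) cu' neq_w) => /= [jk | [eq_jk _ _]].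
  by move: (ltn_trans kj jk); rewrite ltnn.
by move: kj; rewrite eq_jk ltnn.
Qed.

(** When the coordinate at [j] has a single term, no monomials of [S] need be
    compared: the position in the basis decides. *)
Lemma is_initial_single (K : fieldType) (n m : nat) (le : rel 'X_{1..n})
    (V : lmodType {mpoly K[n]}) (e : 'I_m -> V) (j : 'I_m) (u : 'X_{1..n})
    (c : {ffun 'I_m -> {mpoly K[n]}}) :
  (forall k : 'I_m, (k < j)%N -> c k = 0) ->
  (forall u', ((c j)@_u' != 0) = (u' == u)) ->
  is_initial le e (\sum_k c k *: e k) (u, j).
Proof.
move=> c0 cj; exists c; split=> //=; first by rewrite mcoeff_msupp cj.
move=> [u' k] /=; rewrite mcoeff_msupp => cu' neq_w; left => /=.
have [jk|] := ltnP j k; first by [].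
rewrite leq_eqVlt => /orP[/eqP/val_inj eq_kj | /c0 ck0].
  by move: cu' neq_w; rewrite eq_kj cj => /eqP ->; rewrite eqxx.
by move: cu'; rewrite ck0 mcoeff0 eqxx.
Qed.

(** The heart of the argument.  With indices starting at [0], [x_i] is the first
    variable dividing [u], and [i <= q] says that it is among the first [q.+1]
    variables. *)
Lemma initial_div_var (K : fieldType) (n : nat) (le : rel 'X_{1..n})
    (F : nat -> lmodType {mpoly K[n]})
    (gr : forall i, 'rV[int]_n -> F i -> Prop)
    (phi : forall i, {linear F i.+1 -> F i})
    (q m : nat) (e : 'I_m -> F q.+1) (j : 'I_m) (i : 'I_n) (u : 'X_{1..n}) :
  (forall k, fg_graded_free (gr k)) ->
  (forall k a x, gr k.+1 a x -> gr k a (phi k x)) ->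
  (forall k y, phi k y = 0 <-> exists x, phi k.+1 x = y) ->
  lex_refined_basis (gr q.+1) e ->
  (i <= q)%N -> vanish_below i u -> u i != 0%N ->
  (exists v, phi q v = 0 /\ is_initial le e v (u, j)) ->
  exists v, phi q v = 0 /\ is_initial le e v ((u - U_(i))%MM, j).
Proof.
move=> freeF homF exF [he [d [gr_e d_lex]]] iq u0 ui.
move=> [v [phi_v [c [def_v /= cu c_gt]]]]; rewrite {}def_v in phi_v.
have freeF' k := fg_graded_free_basis (freeF k).
have mgF k : multigrading (gr k) by case: (freeF k).
have c0 := is_initial_coord0 c_gt.
have phi_comp (c' : {ffun 'I_m -> {mpoly K[n]}}) a :
    phi q (\sum_k c' k *: e k) = 0 ->
    phi q (\sum_k mhcomp (a - d k) (c' k) *: e k) = 0.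
  move=> phi_c'; apply: kernel_mhcomp (mgF _) (mgF _) _ gr_e phi_c' => b x.
  exact: homF.
(* [z] holds the coordinates of the component of the syzygy that contains the
   monomial [u e_j]. *)
pose a := mdegZ u + d j.
pose z := [ffun k => mhcomp (a - d k) (c k)] : {ffun 'I_m -> {mpoly K[n]}}.
have phi_z : phi q (\sum_k z k *: e k) = 0.
  by under eq_bigr => k _ do rewrite ffunE; apply: phi_comp.
(* A monomial of [z] without variables before [x_i] is divisible by [x_i]: the
   degrees of [e k] and [e j] agree before [i], and lex-refinement compares them
   at [i]. *)
have Mz : var_multiples i.+1 (\sum_k z k *: e k).
  apply/var_multiples_coordP => // k u' u'0; rewrite ffunE mcoeff_mhcomp.
  case: eqP => // deg_u'.
  have [kj | jk] := ltnP k j; first by rewrite c0 // mcoeff0.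
  have deg l : (u' l)%:Z + d k ord0 l = (u l)%:Z + d j ord0 l.
    move/rowP/(_ l): deg_u'; rewrite !mxE => ->; exact: subrK.
  have : d k ord0 i <= d j ord0 i.
    apply: lexle_first (d_lex _ _ jk) _ => l li.
    by have := deg l; rewrite u'0 ?(leq_trans li) // u0 // !add0r => ->.
  have := deg i; rewrite u'0 // add0r => ->.
  by rewrite gerDr lez_nat leqn0 (negPf ui).
have [z' [phi_z' Mz']] := kernel_div_var freeF' exF iq phi_z Mz.
have [c' [def_z' _]] := he z'.
(* Away from the multiples of the variables before [x_i], the coefficients of
   [z'] are those of [z / x_i]. *)
have coef_c' k u' : vanish_below i u' -> (c' k)@_u' = (z k)@_(u' + U_(i))%MM.
  move=> u'0; rewrite -(mcoeff_XM i).
  pose b := [ffun k => z k - 'X_i * c' k] : {ffun 'I_m -> {mpoly K[n]}}.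
  have def_b : \sum_k z k *: e k - 'X_i *: z' = \sum_k b k *: e k.
    rewrite def_z' scaler_sumr -sumrB; apply: eq_bigr => l _.
    by rewrite [b l]ffunE scalerBl scalerA.
  rewrite def_b in Mz'; move/(var_multiples_coordP _ _ he): Mz'.
  move/(_ k (u' + U_(i))%MM); rewrite ffunE mcoeffB => b0.
  apply/esym/eqP; rewrite -subr_eq0 b0 // => l li.
  rewrite mnmDE u'0 // mnm1E; case: eqP => // il.
  by move: li; rewrite il ltnn.
have ui_K : (u - U_(i) + U_(i))%MM = u by rewrite submK // lep1mP.
have vui : vanish_below i (u - U_(i))%MM.
  by move=> l li; rewrite mnmBE u0.
pose a' := mdegZ (u - U_(i))%MM + d j.
pose y := [ffun k => mhcomp (a' - d k) (c' k)] : {ffun 'I_m -> {mpoly K[n]}}.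
exists (\sum_k y k *: e k); split.
  by under eq_bigr => k _ do rewrite ffunE; apply: phi_comp; rewrite -def_z'.
(* For [k < j], the degree of [e k] is at least that of [e j], which forces the
   monomials at [e k] to avoid the variables before [x_i]; their coefficients
   then come from [z], which is zero there. *)
apply: is_initial_single => [k kj | u'].
  apply/mpolyP => u'; rewrite mcoeff0 ffunE mcoeff_mhcomp.
  case: eqP => // deg_u'; rewrite coef_c'.
    by rewrite ffunE c0 // mcoeff_mhcomp mcoeff0 if_same.
  have deg l : (u' l)%:Z + d k ord0 l = ((u - U_(i))%MM l)%:Z + d j ord0 l.
    move/rowP/(_ l): deg_u'; rewrite !mxE => ->; exact: subrK.
  have eq_d : forall l : 'I_n, (l < i)%N -> d j ord0 l = d k ord0 l.
    apply: lexle_first_eq (d_lex _ _ (ltnW kj)) _ => l li.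
    by have := deg l; rewrite vui // add0r => <-; rewrite lerDr.
  move=> l li; have := deg l; rewrite vui // eq_d //.
  by move/addIr => [].
rewrite ffunE mcoeff_mhcomp /a' addrK (inj_eq (@mdegZ_inj n)).
case: (u' =P (u - U_(i))%MM) => [-> | _]; last by rewrite eqxx.
rewrite coef_c' // ui_K ffunE mcoeff_mhcomp /a addrK eqxx.
by rewrite -mcoeff_msupp.
Qed.

(** * Monomial ideals and the initial module *)

Lemma ideal_of_monomials_msupp (K : fieldType) (n : nat)
    (G : 'X_{1..n} -> Prop) (f : {mpoly K[n]}) :
  ideal_of_monomials G f ->
  forall u, u \in msupp f -> exists2 g, G g & (g <= u)%MM.
Proof.
move=> Gf.
pose N (h : {mpoly K[n]}^o) :=
  forall u, u \in msupp (h : {mpoly K[n]}) -> exists2 g, G g & (g <= u)%MM.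
apply: (Gf N) => [|_ [u Gu ->] v]; last first.
  by rewrite msuppX inE => /eqP ->; exists u => //; apply: lepm_refl.
split=> [u | x y Nx Ny u | h x Nx u].
- by rewrite msupp0.
- by move/msuppD_le; rewrite mem_cat => /orP[/Nx | /Ny].
- move/msuppM_le/allpairsP => [[a b] /= [_ /Nx[g Gg gb] ->]]; exists g => //.
  by apply: lepm_trans gb _; apply: lem_addl.
Qed.

Lemma ideal_of_monomialsX (K : fieldType) (n : nat)
    (G : 'X_{1..n} -> Prop) (u : 'X_{1..n}) :
  ideal_of_monomials (K := K) G 'X_[u] <-> exists2 g, G g & (g <= u)%MM.
Proof.
split=> [/ideal_of_monomials_msupp | [g Gg gu] N sN GN].
  by apply; rewrite msuppX mem_head.
rewrite -(submK gu) mpolyXD; apply: (submZ sN).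
by apply: GN; exists g.
Qed.

Lemma ideal_of_monomialsS (K : fieldType) (n : nat)
    (G H : 'X_{1..n} -> Prop) :
  (forall u, G u -> exists2 g, H g & (g <= u)%MM) ->
  forall f : {mpoly K[n]}^o, ideal_of_monomials G f -> ideal_of_monomials H f.
Proof.
move=> GH f Gf; apply: Gf; first exact: generated_submodule.
by move=> _ [u /GH Hu ->]; apply/ideal_of_monomialsX.
Qed.

(** The elements of [A] that are minimal for divisibility. *)
Definition minimal_monomials (n : nat) (A : 'X_{1..n} -> Prop) (u : 'X_{1..n}) :=
  A u /\ forall v, A v -> (v <= u)%MM -> v = u.

Lemma minimal_monomials_below (n : nat) (A : 'X_{1..n} -> Prop) (u : 'X_{1..n}) :
  A u -> exists2 g, minimal_monomials A g & (g <= u)%MM.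
Proof.
have [k] := ubnP (mdeg u); elim: k u => // k IHk u deg_u Au.
have [min_u | not_min] := classic (minimal_monomials A u).
  by exists u => //; apply: lepm_refl.
have [v [Av vu neq_vu]] : exists v, [/\ A v, (v <= u)%MM & v <> u].
  apply: NNPP => no_v; case: not_min; split=> // v Av vu.
  by apply: NNPP => neq_vu; case: no_v; exists v.
have deg_v : (mdeg v < k)%N.
  rewrite ltnS in deg_u; apply: leq_trans deg_u.
  rewrite -(submK vu) mdegD -[X in (X < _)%N]add0n ltn_add2r lt0n mdeg_eq0.
  by apply/eqP => uv0; apply: neq_vu; rewrite -[RHS](submK vu) uv0 add0m.
have [g min_g gv] := IHk v deg_v Av.
by exists g => //; apply: lepm_trans gv vu.
Qed.

Lemma min_monomial_gens_antichain (K : fieldType) (n : nat)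
    (I : {mpoly K[n]}^o -> Prop) (G : 'X_{1..n} -> Prop) u v :
  min_monomial_gens I G -> G u -> G v -> (v <= u)%MM -> v = u.
Proof.
move=> [genG minG] Gu Gv vu; apply: NNPP => neq_vu.
have [||_] := minG (fun w => G w /\ w <> u) _ _ u Gu; try by [].
  by move=> w [].
move=> f; rewrite genG; split; apply: ideal_of_monomialsS => w Gw.
  have [-> | neq_wu] := classic (w = u); first by exists v.
  by exists w => //; apply: lepm_refl.
by exists w; [case: Gw | apply: lepm_refl].
Qed.

(** The minimal monomial generators belong to every monomial generating set; in
    particular they are unique. *)
Lemma min_monomial_gens_sub (K : fieldType) (n : nat)
    (I : {mpoly K[n]}^o -> Prop) (G H : 'X_{1..n} -> Prop) u :
  min_monomial_gens I G -> generates H I -> G u -> H u.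
Proof.
move=> minG genH Gu.
have [g Hg gu] : exists2 g, H g & (g <= u)%MM.
  apply/(ideal_of_monomialsX K)/genH/(proj1 minG)/ideal_of_monomialsX.
  by exists u => //; apply: lepm_refl.
have [g' Gg' g'g] : exists2 g', G g' & (g' <= g)%MM.
  apply/(ideal_of_monomialsX K)/(proj1 minG)/genH/ideal_of_monomialsX.
  by exists g => //; apply: lepm_refl.
have eq_g'u := min_monomial_gens_antichain minG Gu Gg' (lepm_trans g'g gu).
suff -> : u = g by [].
apply/mnmP => i; apply/eqP; rewrite eqn_leq (mnm_lepP gu) andbT.
by rewrite -eq_g'u (mnm_lepP g'g).
Qed.

Lemma minimal_monomials_gens (K : fieldType) (n : nat) (A : 'X_{1..n} -> Prop) :
  min_monomial_gens (K := K) (ideal_of_monomials A) (minimal_monomials A).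
Proof.
split=> [f | G' G'_min genG' u [Au min_u]].
  split; apply: ideal_of_monomialsS => u; first exact: minimal_monomials_below.
  by move=> [Au _]; exists u => //; apply: lepm_refl.
have [g G'g gu] : exists2 g, G' g & (g <= u)%MM.
  apply/(ideal_of_monomialsX K)/genG'/ideal_of_monomialsX.
  by exists u => //; apply: lepm_refl.
by have [Ag _] := G'_min g G'g; rewrite -(min_u g Ag gu).
Qed.

(** The initial module is the sum of the [I_j e_j], where [I_j] is the ideal
    generated by the initial monomials that occur at [e_j]. *)
Lemma initial_moduleE (K : fieldType) (n m : nat) (le : rel 'X_{1..n})
    (V : lmodType {mpoly K[n]}) (e : 'I_m -> V) (N : V -> Prop) (v : V) :
  initial_module le e N v <->
  sum_of_ideals e
    (fun j => ideal_of_monomials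
                (fun u => exists v', N v' /\ is_initial le e v' (u, j))) v.
Proof.
pose A (j : 'I_m) (u : 'X_{1..n}) := exists v, N v /\ is_initial le e v (u, j).
have gI j : submodule (V := {mpoly K[n]}^o) (ideal_of_monomials (A j)).
  exact: generated_submodule.
split.
  apply.
    split.
    + exists (fun=> 0); split=> [j|]; first exact: (Defs.subm0 (gI _)).
      by rewrite big1 // => j _; rewrite scale0r.
    + move=> _ _ [c [Ic ->]] [c' [Ic' ->]]; exists (fun j => c j + c' j).
      split=> [j|]; first exact: (submD (gI j) (Ic j) (Ic' j)).
      by rewrite -big_split; apply: eq_bigr => j _; rewrite scalerDl.
    + move=> f _ [c [Ic ->]]; exists (fun j => f * c j).
      split=> [j|]; first exact: (submZ (gI j) f (Ic j)).
      by rewrite scaler_sumr; apply: eq_bigr => j _; rewrite scalerA.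
  move=> _ [v' [[u j] [Nv' init_v' ->]]] /=.
  exists (fun k => if k == j then 'X_[u] else 0); split=> [k|].
    case: eqP => [-> | _]; last exact: (Defs.subm0 (gI _)).
    apply/ideal_of_monomialsX; exists u; last exact: lepm_refl.
    by exists v'.
  rewrite (bigD1 j) //= eqxx big1 ?addr0 // => k /negPf ->.
  by rewrite scale0r.
have sI : submodule (initial_module le e N) by apply: generated_submodule.
move=> [c [Ic ->]]; apply: (subm_sum sI) => j _.
apply: (Ic j (fun f => initial_module le e N (f *: e j)))
  => [|_ [u [v' [Nv' init_v']] ->]].
  split=> [|x y Ix Iy|f x Ix].
  + by rewrite scale0r; apply: (Defs.subm0 sI).
  + by rewrite scalerDl; apply: (submD sI).
  + by rewrite -[f *: x]/(f * x) -scalerA; apply: (submZ sI).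
by move=> N' sN' XN'; apply: XN'; exists v', (u, j).
Qed.

Theorem theorem1p1 (K : fieldType) (n : nat) (le : rel 'X_{1..n})
  (hle : monomial_order le)
  (F : nat -> lmodType {mpoly K[n]})
  (gr : forall i, 'rV[int]_n -> F i -> Prop)
  (M : F 0%N -> Prop)
  (phi : forall i, {linear F i.+1 -> F i})
  (hF0 : fg_graded_free (gr 0%N))
  (hM : graded_submodule (gr 0%N) M)
  (hres : graded_free_resolution gr M phi)
  (p : nat) (hp : (p <= n)%N)
  (m : nat) (e : 'I_m -> F p) (he : lex_refined_basis (gr p) e) :
  exists I : 'I_m -> {mpoly K[n]}^o -> Prop,
    [/\ forall j, monomial_ideal (I j),
        forall v, initial_module le e (syzygy M phi (p := p)) v <->
                  sum_of_ideals e I v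
      & forall j, exists G : 'X_{1..n} -> Prop,
          [/\ min_monomial_gens (I j) G,
              forall G', min_monomial_gens (I j) G' ->
                         forall u, G' u <-> G u
            & forall u, G u -> in_last_vars p ('X_[u] : {mpoly K[n]})]].
Proof.
set N := syzygy M phi (p := p).
pose A (j : 'I_m) u := exists v, N v /\ is_initial le e v (u, j).
exists (fun j => ideal_of_monomials (A j)); split=> [j | v | j].
- by exists (A j).
- exact: initial_moduleE.
exists (minimal_monomials (A j)).
have minA := minimal_monomials_gens K (A j).
split=> // [G' minG' u | u [Au min_u]].
  split=> Gu.
    exact: min_monomial_gens_sub minG' (proj1 minA) Gu.
  exact: min_monomial_gens_sub minA (proj1 minG') Gu.
move=> u'; rewrite msuppX inE => /eqP -> i ip; apply/eqP; apply: contraLR isT => ui.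
(* [x_i0] is the first variable dividing [u]. *)
have [i0 ui0 min_i0] :=
  arg_minnP (P := fun l : 'I_n => u l != 0%N) (fun l : 'I_n => l : nat) ui.
case: p hp e he @N @A Au min_u {minA} ip => // q _ e he N A Au min_u iq.
have freeF k : fg_graded_free (gr k) by case: k => // k; apply: (gfr_free hres).
have vu : vanish_below i0 u.
  move=> l li0; apply/eqP; apply: contraLR li0 => /min_i0.
  by rewrite -leqNgt.
have i0q : (i0 <= q)%N by apply: leq_trans (min_i0 i ui) _.
have Au' :=
  initial_div_var freeF (gfr_homog hres) (gfr_exact hres) he i0q vu ui0 Au.
have eq_u := min_u _ Au' (lem_subr _ _).
move/mnmP/(_ i0): eq_u; rewrite mnmBE mnm1E eqxx => eq_ui.
by move: ui0 eq_ui; rewrite subn1; case: (u i0) => //= k _ /eqP; rewrite ltn_eqF.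
Qed.
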